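(* Let $n\geq 3$ be a positive integer. Then: (1) $t(3,3,2)=2$, $t(4,3,2)=4$, and $t(5,3,2)=\binom{5}{2}$. Furthermore, when $n\geq 6$, there does not exist a connected graph $G$ of order $n$ such that $rx_3(G)\leq 2$. (2) $t(3,3,3)=2$, $t(4,3,3)=3$, and $t(5,3,3)=5$. Furthermore, when $n\geq 6$, $$t(n,3,3)\leq \begin{cases}\dfrac{n^2}{4}, & \text{if } n \text{ is even};\\[2mm] \dfrac{(n+3)(n-1)}{4}, & \text{if } n \text{ is odd}.\end{cases}$$
   Context: All graphs are finite, undirected and simple. Let $G$ be a nontrivial connected graph of order $n$ (i.e. with $n$ vertices). An edge-coloring of $G$ is any assignment of colors to the edges (adjacent edges may receive the same color). A tree $T$ that is a subgraph of $G$ is a rainbow tree if no two edges of $T$ have the same color. For $S\subseteq V(G)$ with $|S|\geq 2$, a rainbow $S$-tree is a rainbow tree $T$ in $G$ with $S\subseteq V(T)$. For an integer $k$ with $2\leq k\leq n$, an edge-coloring of $G$ is a $k$-rainbow coloring if for every $k$-subset $S$ of $V(G)$ there exists a rainbow $S$-tree. The $k$-rainbow index $rx_k(G)$ is the minimum number of colors needed in a $k$-rainbow coloring of $G$. For integers $2\leq k\leq n$ and $\ell\geq 2$, $t(n,k,\ell)$ denotes the minimum size (number of edges) of a connected graph $G$ of order $n$ with $rx_k(G)\leq \ell$ (when such a graph exists). *)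

(* Defs.v *)
(* Mathematical Components *)
From HB Require Import structures.
From mathcomp Require Import all_boot.
Set Implicit Arguments.
Unset Strict Implicit.
Unset Printing Implicit Defensive.

Record sgraph := SGraph {
  vertex :> finType;
  adj : rel vertex;
  adj_sym : symmetric adj;
  adj_irrefl : irreflexive adj
}.

Definition edges (G : sgraph) : {set {set G}} :=
  [set e : {set G} | [exists x, exists y, adj x y && (e == [set x; y])]].

Definition connected_graph (G : sgraph) : Prop :=
  0 < #|G| /\ forall x y : G, connect (@adj G) x y.

Record subgraph (G : sgraph) := Subgraph {
  sverts : {set G};
  sedges : {set {set G}};
  sedges_edges : sedges \subset edges G;
  sedges_sverts : forall e, e \in sedges -> e \subset sverts
}.

(* Irreflexive, since singletons are not edges of G. *)
Definition sadj (G : sgraph) (H : subgraph G) : rel G :=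
  [rel x y | [set x; y] \in sedges H].

Definition sconnected (G : sgraph) (H : subgraph G) : Prop :=
  sverts H != set0 /\
  {in sverts H &, forall x y, connect (sadj H) x y}.

Definition sacyclic (G : sgraph) (H : subgraph G) : Prop :=
  ~ exists s : seq G, 2 < size s /\ ucycle (sadj H) s.

Definition is_tree (G : sgraph) (H : subgraph G) : Prop :=
  sconnected H /\ sacyclic H.

(* Only the values on [edges G] are ever used. *)
Definition edge_coloring (G : sgraph) := {set G} -> nat.

Definition num_colors (G : sgraph) (c : edge_coloring G) : nat :=
  size (undup [seq c e | e in edges G]).

Definition rainbow_tree (G : sgraph) (c : edge_coloring G) (H : subgraph G) :
  Prop := is_tree H /\ {in sedges H &, injective c}.

Definition rainbow_S_tree (G : sgraph) (c : edge_coloring G) (S : {set G})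
  (H : subgraph G) : Prop := rainbow_tree c H /\ S \subset sverts H.

Definition k_rainbow_coloring (k : nat) (G : sgraph) (c : edge_coloring G) :
  Prop :=
  forall S : {set G}, #|S| = k -> exists H : subgraph G, rainbow_S_tree c S H.

Definition is_minimum (P : nat -> Prop) (m : nat) : Prop :=
  P m /\ forall j, P j -> m <= j.

(* [is_rx k G r] reads rx_k(G) = r. For G connected and 2 <= k <= #|G| such an
   r exists, because an injective edge-coloring is k-rainbow. *)
Definition is_rx (k : nat) (G : sgraph) (r : nat) : Prop :=
  is_minimum
    (fun m => exists c : edge_coloring G,
       k_rainbow_coloring k c /\ num_colors c = m) r.

Definition rx_le (k : nat) (G : sgraph) (l : nat) : Prop :=
  exists r, is_rx k G r /\ r <= l.

(* [is_t n k l m] reads t(n,k,l) = m; t is a relation because for some n, k, l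
   no suitable graph exists. *)
Definition is_t (n k l m : nat) : Prop :=
  is_minimum
    (fun s => exists G : sgraph,
       [/\ #|G| = n, connected_graph G, rx_le k G l & #|edges G| = s]) m.

(* t(n,k,l) <= b, including that t(n,k,l) is defined. *)
Definition t_le (n k l b : nat) : Prop := exists m, is_t n k l m /\ m <= b.

(* Main.v *)
Require Import Defs.
From HB Require Import structures.
From mathcomp Require Import all_boot zify.
From Stdlib Require Import Classical_Prop.

(** With only two colors a rainbow tree has at most two edges, so a rainbow tree
    through a triple lives on the triple itself, and the triple spans two
    adjacent edges of different colors.  From five vertices on this forces the
    graph to be complete (the neighbours of a nonadjacent pair u, v would
    include two, w1 and w2, giving contradictory requirements on the color of
    w1w2); with six vertices Ramsey's R(3,3) = 6 gives a monochromatic triple.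

    With three colors, a tree on five vertices fails: if it has at most three
    leaves, a rainbow tree through them is the whole tree, which has four edges;
    otherwise it is a star, and any two of its edges need different colors.

    For the general upper bound take K_{k,k}, plus, when n is odd, an apex
    joined to all its vertices.  Color u_i v_j according to whether i = j, i < j
    or i > j: the star centered at v_j then joins u_i, u_j, u_l for i < j < l by
    a rainbow tree, and the other triples are as easy. *)

Set Implicit Arguments.
Unset Strict Implicit.
Unset Printing Implicit Defensive.

(** * Unordered pairs as edges, and existence of minima *)

Lemma set2_eq (T : finType) (x y a b : T) :
  x != y -> [set x; y] = [set a; b] -> x = a /\ y = b \/ x = b /\ y = a.
Proof.
move=> nxy E; have := set21 x y; have := set22 x y; rewrite E !inE.
by case/orP=> /eqP Ey /orP[] /eqP Ex; subst; rewrite ?eqxx // in nxy; auto.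
Qed.

(** Descent below the bound [m]; [P] is an arbitrary proposition, so the existence of a smaller
    solution is decided classically. *)
Lemma is_minimum_exists (P : nat -> Prop) m :
  P m -> exists r, is_minimum P r /\ r <= m.
Proof.
have [k] := ubnP m; elim: k m => // k IH m; rewrite ltnS => mk Pm.
case: (classic (exists2 j, P j & j < m)) => [[j Pj jm]|nP].
  have [r [Pr rj]] := IH j (leq_trans jm mk) Pj.
  by exists r; split=> //; apply: leq_trans rj (ltnW jm).
exists m; split=> //; split=> // j Pj; rewrite leqNgt; apply/negP => jm.
by apply: nP; exists j.
Qed.

Lemma edge_in (G : sgraph) (x y : G) : adj x y -> [set x; y] \in edges G.
Proof.
move=> xy; rewrite inE; apply/existsP; exists x; apply/existsP; exists y.
by rewrite xy eqxx.
Qed.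

Lemma edgesP (G : sgraph) (e : {set G}) :
  reflect (exists x y, adj x y /\ e = [set x; y]) (e \in edges G).
Proof.
apply: (iffP idP) => [|[x [y [xy ->]]]]; last exact: edge_in.
by rewrite inE => /existsP[x /existsP[y /andP[xy /eqP->]]]; exists x, y.
Qed.

Lemma adj_neq (G : sgraph) (x y : G) : adj x y -> x != y.
Proof. by apply: contraTneq => ->; rewrite adj_irrefl. Qed.

Lemma edge_adj (G : sgraph) (x y : G) : ([set x; y] \in edges G) = adj x y.
Proof.
apply/idP/idP => [/edgesP[a [b [ab E]]]|]; last exact: edge_in.
by case: (set2_eq (adj_neq ab) (esym E)) => -[<- <-] //; rewrite adj_sym.
Qed.

Lemma card_edge (G : sgraph) (e : {set G}) : e \in edges G -> #|e| = 2.
Proof. by case/edgesP=> x [y [xy ->]]; rewrite cards2 (adj_neq xy). Qed.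

Lemma sadjE (G : sgraph) (H : subgraph G) x y :
  sadj H x y = ([set x; y] \in sedges H).
Proof. by []. Qed.

Lemma sadj_sym (G : sgraph) (H : subgraph G) : symmetric (sadj H).
Proof. by move=> x y; rewrite !sadjE setUC. Qed.

(** * Building rainbow trees leaf by leaf *)

(** The vertex set is exact, so a vertex outside [V] is new to the tree; [C] only has to contain the
    colors used, which is enough to certify that a color is fresh. *)
Definition has_rainbow_tree (G : sgraph) (c : edge_coloring G)
    (V : {set G}) (C : seq nat) :=
  exists H : subgraph G,
    [/\ rainbow_tree c H, sverts H = V & {in sedges H, forall e, c e \in C}].

Lemma has_rainbow_tree1 (G : sgraph) (c : edge_coloring G) (r : G) :
  has_rainbow_tree c [set r] [::].
Proof.
have sub0 : (set0 : {set {set G}}) \subset edges G by rewrite sub0set.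
have sub1 e : e \in (set0 : {set {set G}}) -> e \subset [set r] by rewrite inE.
exists (Subgraph sub0 sub1); split=> //= [|e]; last by rewrite inE.
split=> [|x y]; last by rewrite inE.
split; first split=> /=; first by apply/set0Pn; exists r; rewrite inE.
  by move=> x y; rewrite !inE => /eqP-> /eqP->; exact: connect0.
case=> -[|x [|y s]] [] //= _ /andP[/andP[]].
by rewrite sadjE inE.
Qed.

Lemma has_rainbow_tree_leaf (G : sgraph) (c : edge_coloring G) V C (x z : G) :
  has_rainbow_tree c V C -> x \in V -> z \notin V -> adj x z ->
  c [set x; z] \notin C ->
  has_rainbow_tree c (z |: V) (c [set x; z] :: C).
Proof.
case=> H [[[[_ Hcon] Hacy] Hinj] <- HC] xV zV xz cC.
have sub1 : [set x; z] |: sedges H \subset edges G.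
  by rewrite subUset sub1set edge_in // sedges_edges.
have sub2 e : e \in [set x; z] |: sedges H -> e \subset z |: sverts H.
  rewrite !inE => /predU1P[->|/sedges_sverts/subset_trans->//];
    last exact: subsetUr.
  by apply/subsetP=> t; rewrite !inE => /orP[]/eqP->; rewrite ?xV ?eqxx ?orbT.
pose H' := Subgraph sub1 sub2.
have zNe y : [set z; y] \notin sedges H.
  apply/negP => /sedges_sverts/subsetP/(_ z); rewrite set21 => /(_ isT).
  exact/negP.
have zadj y : sadj H' z y -> y = x.
  move=> zy; have/adj_neq nzy : adj z y.
    by rewrite -edge_adj; apply: (subsetP sub1).
  move: zy; rewrite sadjE in_setU1 (negPf (zNe y)) orbF => /eqP.
  by case/(set2_eq nzy) => -[// _ Eyz]; rewrite Eyz eqxx in nzy.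
exists H'; split=> //=; last first.
  move=> e; rewrite !inE => /predU1P[->|/HC->]; rewrite ?eqxx ?orbT //.
split; first split; first split.
- by apply/set0Pn; exists z; rewrite !inE eqxx.
- have subH : subrel (connect (sadj H)) (connect (sadj H')).
    apply: connect_sub => a b ab; apply: connect1.
    by rewrite sadjE in_setU1; apply/orP; right.
  have csym := sym_connect_sym (@sadj_sym _ H').
  have zx : connect (sadj H') z x.
    by apply: connect1; rewrite sadjE setUC setU11.
  move=> a b; rewrite !inE => /predU1P[->|aV] /predU1P[->|bV].
  + exact: connect0.
  + exact: connect_trans zx (subH _ _ (Hcon _ _ xV bV)).
  + by rewrite csym; exact: connect_trans zx (subH _ _ (Hcon _ _ xV aV)).
  + exact: subH _ _ (Hcon _ _ aV bV).
- case=> s [s2 /andP[scyc suniq]].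
  (* Rotate the cycle to start at [z]: its second and last vertices are both [x], the only neighbor
     of [z], which contradicts uniqueness. *)
  have [zs|zs] := boolP (z \in s).
    have [i s' Es] := rot_to zs.
    move: scyc suniq s2; rewrite -(rot_cycle i) -(rot_uniq i) -(size_rot i) Es.
    case: s' {Es} => [|y [|t s']] //= /andP[/zadj-> /andP[_]].
    rewrite rcons_path => /andP[_]; rewrite sadj_sym => /zadj Ex.
    by move=> /and3P[_ + _]; rewrite -[x in x \notin _]Ex mem_last.
  (* A cycle that avoids [z] uses edges of [H] only. *)
  apply: Hacy; exists s; split=> //; rewrite /ucycle suniq andbT.
  move: scyc; apply: (@sub_in_cycle _ (predC1 z)); last first.
    by apply/allP=> t ts; apply: contraNneq zs => <-.
  move=> a b az bz; rewrite sadjE in_setU1 => /orP[/eqP E|//].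
  have : z \in [set a; b] by rewrite E set22.
  by rewrite !inE ![z == _]eq_sym (negPf az) (negPf bz).
- move=> e f; rewrite /= !in_setU1.
  case/predU1P=> [->|eH] /predU1P[->|fH] //; last exact: Hinj.
  + by move=> E; rewrite E HC in cC.
  + by move=> E; rewrite -E HC in cC.
Qed.

(** The ordered pair that represents an edge is picked arbitrarily; on edges the choice is harmless
    once [col] is symmetric. *)
Definition coloring_of (G : sgraph) (col : G -> G -> nat) : edge_coloring G :=
  fun e => if [pick p : G * G | e == [set p.1; p.2]] is Some p
           then col p.1 p.2 else 0.

Lemma coloring_ofE (G : sgraph) (col : G -> G -> nat) :
  (forall x y, col x y = col y x) ->
  forall x y, adj x y -> coloring_of col [set x; y] = col x y.
Proof.
move=> csym x y xy; rewrite /coloring_of; case: pickP => [[a b] /= /eqP E|].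
  by case: (set2_eq (adj_neq xy) E) => -[-> ->].
by move/(_ (x, y)); rewrite eqxx.
Qed.

Section Attach.
Variables (G : sgraph) (col : G -> G -> nat).
Hypothesis csym : forall x y, col x y = col y x.

(* [attach V C p] checks that the successive pairs (x, z) of p each hang a new
   leaf z on x, along an edge of a new color; V and C are the vertices and the
   colors already used. *)
Fixpoint attach (V : seq G) (C : seq nat) (p : seq (G * G)) : bool :=
  if p is (x, z) :: p' then
    [&& x \in V, z \notin V, adj x z, col x z \notin C
      & attach (z :: V) (col x z :: C) p']
  else true.

(** [catrev] matches the way [attach] pushes each new leaf onto the front of [V]. *)
Lemma attach_tree V C p : attach V C p ->
  has_rainbow_tree (coloring_of col) [set x in V] C ->
  exists C', has_rainbow_tree (coloring_of col)
               [set x in catrev (unzip2 p) V] C'.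
Proof.
elim: p V C => [|[x z] p IH] V C /=; first by exists C.
case/and5P=> xV zV xz cC att HT; apply: IH att _.
have := @has_rainbow_tree_leaf _ _ _ _ x z HT.
rewrite !inE coloring_ofE // xV zV xz cC -set_cons; exact.
Qed.

(** The root and the list of attachments form a certificate checkable by computation; the tree may
    pass through vertices outside [s]. *)
Definition spanned (s : seq G) :=
  exists r p, attach [:: r] [::] p /\ {subset s <= r :: unzip2 p}.

Lemma k_rainbow_of_spanned k :
  (forall s : seq G, size s = k -> uniq s -> spanned s) ->
  k_rainbow_coloring k (coloring_of col).
Proof.
move=> sp S Sk; have [|//|r [p [att sub]]] := sp (enum S).
- by rewrite -cardE.
- exact: enum_uniq.
have [|C' [H [HT HV _]]] := attach_tree att.
  have -> : [set x in [:: r]] = [set r] by apply/setP=> x; rewrite !inE.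
  exact: has_rainbow_tree1.
exists H; split=> //; rewrite HV; apply/subsetP=> x xS.
have /sub : x \in enum S by rewrite mem_enum.
by rewrite !inE catrevE mem_cat mem_rev inE orbC.
Qed.
End Attach.

(** * From colorings to bounds on the rainbow index and on t(n,k,l) *)

Lemma subset_of_card (T : finType) (A : {set T}) k :
  #|A| <= k <= #|T| -> exists2 S : {set T}, A \subset S & #|S| = k.
Proof.
case/andP; elim: k => [|k IH].
  by rewrite leqn0 => /eqP A0 _; exists A.
rewrite leq_eqVlt => /predU1P[Ak|]; first by exists A.
rewrite ltnS => Ak kT; have [S AS Sk] := IH Ak (ltnW kT).
have /set0Pn[x] : ~: S != set0 by rewrite -card_gt0 cardsCs setCK subn_gt0 Sk.
rewrite inE => xS; exists (x |: S); last by rewrite cardsU1 xS Sk.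
exact: subset_trans AS (subsetUr _ _).
Qed.

Lemma num_colors_le (G : sgraph) (c : edge_coloring G) l :
  {in edges G, forall e, c e < l} -> num_colors c <= l.
Proof.
move=> cl; rewrite -[l in _ <= l](size_iota 0 l).
apply: uniq_leq_size => [|i]; first exact: undup_uniq.
by rewrite mem_undup mem_iota => /mapP[e]; rewrite mem_enum => /cl ? ->.
Qed.

(** Any two vertices extend to a k-subset, whose rainbow tree joins them; a witness thus gets its
    connectedness from its coloring. *)
Lemma k_rainbow_connected (G : sgraph) (c : edge_coloring G) k :
  1 < k <= #|G| -> k_rainbow_coloring k c -> connected_graph G.
Proof.
case/andP=> k1 kG rb; split=> [|x y]; first by apply: leq_trans kG; apply: ltnW.
have [|S xyS Sk] := @subset_of_card _ [set x; y] k.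
  by rewrite cards2 kG andbT; apply: leq_trans k1; case: eqP.
have [H [[[[_ Hc] _] _] SH]] := rb S Sk.
have [xH yH] : x \in sverts H /\ y \in sverts H.
  by split; apply: (subsetP SH); apply: (subsetP xyS); rewrite !inE eqxx ?orbT.
apply: connect_sub (Hc x y xH yH) => a b; rewrite sadjE => ab.
by apply: connect1; rewrite -edge_adj (subsetP (sedges_edges H)).
Qed.

Lemma rx_leP k (G : sgraph) l :
  rx_le k G l <->
  exists c : edge_coloring G, k_rainbow_coloring k c /\ num_colors c <= l.
Proof.
split=> [[r [[[c [rb Ec]] _] rl]]|[c [rb cl]]]; first by exists c; rewrite Ec.
have [|r [rP rc]] := @is_minimum_exists (fun m => exists c : edge_coloring G,
  k_rainbow_coloring k c /\ num_colors c = m) (num_colors c); first by exists c.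
by exists r; split=> //; exact: leq_trans cl.
Qed.

(** An upper bound on the size is easier to certify than equality: a list covering the edges
    suffices, and a matching lower bound restores equality. *)
Definition t_witness n k l m :=
  exists G : sgraph,
    [/\ #|G| = n, connected_graph G, rx_le k G l & #|edges G| <= m].

Lemma t_le_of_witness n k l m : t_witness n k l m -> t_le n k l m.
Proof.
case=> G [Gn Gc Grx Gm].
have [|r [rP rm]] := @is_minimum_exists (fun s => exists G : sgraph,
  [/\ #|G| = n, connected_graph G, rx_le k G l & #|edges G| = s]) #|edges G|.
  by exists G.
by exists r; split=> //; exact: leq_trans Gm.
Qed.

Lemma is_t_of_witness n k l m :
  t_witness n k l m ->
  (forall G : sgraph, #|G| = n -> connected_graph G -> rx_le k G l ->
     m <= #|edges G|) ->
  is_t n k l m.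
Proof.
case=> G [Gn Gc Grx Gm] lb; split=> [|j [G' [? ? ? <-]]]; last exact: lb.
by exists G; split=> //; apply/eqP; rewrite eqn_leq Gm lb.
Qed.

Lemma t_witness_of_spanned (G : sgraph) (col : G -> G -> nat)
    (es : seq {set G}) l :
  2 < #|G| -> (forall x y, col x y = col y x) -> (forall x y, col x y < l) ->
  (forall x y, adj x y -> [set x; y] \in es) ->
  (forall x y z, uniq [:: x; y; z] -> spanned col [:: x; y; z]) ->
  t_witness #|G| 3 l (size es).
Proof.
move=> G2 csym cl Ges sp.
have rb : k_rainbow_coloring 3 (coloring_of col).
  apply: k_rainbow_of_spanned => // -[|x [|y [|z [|? ?]]]] // _; exact: sp.
exists G; split=> //.
- exact: k_rainbow_connected rb.
- apply/rx_leP; exists (coloring_of col); split=> //; apply: num_colors_le.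
  by move=> e /edgesP[x [y [xy ->]]]; rewrite coloring_ofE.
- apply: leq_trans (card_size es); apply: subset_leq_card.
  by apply/subsetP=> e /edgesP[x [y [xy ->]]]; apply: Ges.
Qed.

(** * Explicit graphs of order at most five, checked by computation *)

Definition list_adj n (es : seq (nat * nat)) : rel 'I_n :=
  fun x y => (x != y) && (((val x, val y) \in es) || ((val y, val x) \in es)).

Lemma list_adj_sym n es : symmetric (@list_adj n es).
Proof. by move=> x y; rewrite /list_adj eq_sym orbC. Qed.

Lemma list_adj_irrefl n es : irreflexive (@list_adj n es).
Proof. by move=> x; rewrite /list_adj eqxx. Qed.

Definition list_graph n es :=
  SGraph (@list_adj_sym n es) (@list_adj_irrefl n es).

(* The k-th edge of [es], listed in either orientation, has color [nth 0 cs k]. *)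
Definition list_col n (es : seq (nat * nat)) (cs : seq nat) (x y : 'I_n) :=
  nth 0 cs (minn (index (val x, val y) es) (index (val y, val x) es)).

Definition spanned_by (G : sgraph) (col : G -> G -> nat)
    (ts : seq (G * seq (G * G))) (s : seq G) :=
  has (fun t => attach col [:: t.1] [::] t.2
         && all (fun x => x \in t.1 :: unzip2 t.2) s) ts.

Lemma spanned_byP (G : sgraph) (col : G -> G -> nat) ts s :
  spanned_by col ts s -> spanned col s.
Proof. by case/hasP=> -[r p] _ /andP[att /allP sub]; exists r, p. Qed.

Lemma list_witness n es cs ts l
    (col := @list_col n es cs : list_graph n es -> list_graph n es -> nat) :
  2 < n -> all (fun i => i < l.+1) cs ->
  (forall x y z, uniq [:: x; y; z] ==> spanned_by col ts [:: x; y; z]) ->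
  t_witness n 3 l.+1 (size es).
Proof.
move=> n2 /allP csl sp; rewrite -[n in t_witness n _ _ _]card_ord.
rewrite -(size_map (fun p =>
  [set x : 'I_n | (val x == p.1) || (val x == p.2)])).
apply: (@t_witness_of_spanned (list_graph n es) col) => //
  [|x y|x y|x y|x y z u].
- by rewrite card_ord.
- by rewrite /col /list_col minnC.
- rewrite /col /list_col; set i := minn _ _.
  have [i_s|s_i] := ltnP i (size cs).
    by apply: csl; apply: mem_nth.
  (* Past the end of [cs] the default color is 0, which is below [l.+1]. *)
  by rewrite nth_default.
- case/andP=> _ /orP[] xy; apply/mapP;
  [exists (val x, val y) | exists (val y, val x)] => //=;
  by apply/setP=> t; rewrite !inE // orbC.
- by apply: (@spanned_byP _ _ ts); exact: (implyP (sp x y z)).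
Qed.

(** Iterating the cyclic successor makes indices wrap around modulo [n.+1], which suits families of
    trees obtained by rotation. *)
Definition ordn n i : 'I_n.+1 := iter i (@ordS n.+1) ord0.

Ltac check_triples := by do 3![case=> [] [|[|[|[|[|?]]]]] ? //]; vm_compute.

Lemma witness_3_2 : t_witness 3 3 2 2.
Proof.
pose o := ordn 2.
pose ts := [:: (o 0, [:: (o 0, o 1); (o 1, o 2)])].
apply: (@list_witness 3 [:: (0, 1); (1, 2)] [:: 0; 1] ts) => //.
check_triples.
Qed.

(** The 4-cycle with alternating colors: every triple forms a path of two consecutive edges. *)
Lemma witness_4_2 : t_witness 4 3 2 4.
Proof.
pose o := ordn 3.
pose ts := [seq (o i, [:: (o i, o i.+1); (o i.+1, o i.+2)]) | i <- iota 0 4].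
apply: (@list_witness 4 [:: (0, 1); (1, 2); (2, 3); (3, 0)]
                        [:: 0; 1; 0; 1] ts) => //.
check_triples.
Qed.

(** The complete graph split into a pentagon of color 0 and a pentagram of color 1. Up to rotation a
    triple is {i, i+1, i+2} or {i, i+1, i+3}, and at i it has one edge of each kind. *)
Lemma witness_5_2 : t_witness 5 3 2 10.
Proof.
pose o := ordn 4.
pose ts := ([seq (o i, [:: (o i, o i.+1); (o i, o i.+2)]) | i <- iota 0 5]
  ++ [seq (o i, [:: (o i, o i.+1); (o i, o (i + 3))]) | i <- iota 0 5]).
apply: (@list_witness 5
  [:: (0, 1); (1, 2); (2, 3); (3, 4); (4, 0);
      (0, 2); (2, 4); (4, 1); (1, 3); (3, 0)]
  [:: 0; 0; 0; 0; 0; 1; 1; 1; 1; 1] ts) => //.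
check_triples.
Qed.

Lemma witness_3_3 : t_witness 3 3 3 2.
Proof.
have [G [? ? /rx_leP[c [? c2]] ?]] := witness_3_2.
exists G; split=> //; apply/rx_leP; exists c; split=> //.
exact: leq_trans c2 _.
Qed.

Lemma witness_4_3 : t_witness 4 3 3 3.
Proof.
pose o := ordn 3.
pose ts := [:: (o 0, [:: (o 0, o 1); (o 1, o 2); (o 2, o 3)])].
apply: (@list_witness 4 [:: (0, 1); (1, 2); (2, 3)] [:: 0; 1; 2] ts) => //.
check_triples.
Qed.

(** On the 5-cycle colored 0, 1, 2, 0, 1, three rainbow paths of four vertices omit 4, 0 and 1
    respectively. Only the triple {0, 1, 4} lies in none of them; it gets its own path. *)
Lemma witness_5_3 : t_witness 5 3 3 5.
Proof.
pose o := ordn 4.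
pose ts := ((o 4, [:: (o 4, o 0); (o 0, o 1)])
  :: [seq (o i, [:: (o i, o i.+1); (o i.+1, o i.+2); (o i.+2, o (i + 3))])
       | i <- iota 0 3]).
apply: (@list_witness 5 [:: (0, 1); (1, 2); (2, 3); (3, 4); (4, 0)]
                        [:: 0; 1; 2; 0; 1] ts) => //.
check_triples.
Qed.

(** * The general upper bound: a balanced complete bipartite graph, with an apex for odd order *)

Section ApexBipartite.
Variables (k : nat) (b : bool).
(** Through the coercion of [b] to a number, ['I_b] is empty or a singleton, so both parities are
    treated at once. *)
Let V : finType := ((bool * 'I_k) + 'I_b)%type.

(* [inl (false, i)], [inl (true, j)] and [inr w] are u_i, v_j and the apex. *)
Definition apex_adj : rel V := fun x y =>
  match x, y with
  | inl (s, _), inl (t, _) => s != t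
  | inr _, inr _ => false
  | _, _ => true
  end.

Lemma apex_adj_sym : symmetric apex_adj.
Proof. by move=> [[s i]|w] [[t j]|w'] //=; rewrite eq_sym. Qed.

Lemma apex_adj_irrefl : irreflexive apex_adj.
Proof. by move=> [[s i]|w] //=; rewrite eqxx. Qed.

Definition apex_graph := SGraph apex_adj_sym apex_adj_irrefl.

(* For i <> j the color of u_i v_j is 2 if i < j and 1 if i > j; the apex edges
   have color 2 towards the u_i and 1 towards the v_j. *)
Definition apex_col (x y : apex_graph) : nat :=
  match x, y with
  | inl (s, i), inl (t, j) =>
      if (i == j) || (s == t) then 0 else ((i < j) (+) s).+1
  | inl (s, _), inr _ | inr _, inl (s, _) => (~~ s).+1
  | inr _, inr _ => 0
  end.

(** Exchanging the ends of a cross edge with i <> j negates both the comparison and the side, so the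
    exclusive or is unchanged. *)
Lemma apex_col_sym x y : apex_col x y = apex_col y x.
Proof.
case: x y => [[s i]|w] [[t j]|w'] //=; rewrite eq_sym [s == t]eq_sym.
case: eqVneq => //= nij; have := nij; rewrite neq_ltn => /orP[] ij;
by rewrite ij ltnNge ltnW //=; case: s t => [] [].
Qed.

Lemma apex_col_lt3 x y : apex_col x y < 3.
Proof.
have lt3 (a : bool) : a.+1 < 3 by case: a.
by case: x y => [[s i]|w] [[t j]|w'] //=; case: ifP.
Qed.

Definition side (s : bool) (i : 'I_k) : apex_graph := inl (s, i).

Lemma side_eq s t i j : (side s i == side t j) = (s == t) && (i == j).
Proof. by []. Qed.

(** A product of equations, used as one rewrite rule that settles every comparison between two
    ordered indices. *)
Lemma ltn_ord_rules (i j : 'I_k) : i < j ->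
  ((i == j) = false) * ((j == i) = false) *
  ((i < j) = true) * ((j < i) = false).
Proof.
by move=> ij; rewrite -!val_eqE /= ltn_eqF ?gtn_eqF // ij ltnNge ltnW.
Qed.

Lemma spanned_perm (s t : seq apex_graph) :
  perm_eq s t -> spanned apex_col s -> spanned apex_col t.
Proof.
move=> /perm_mem st [r [p [att sub]]]; exists r, p; split=> // x.
by rewrite -st; apply: sub.
Qed.

Lemma perm_swap12 (x y z : apex_graph) : perm_eq [:: x; y; z] [:: y; x; z].
Proof. by apply/permP=> a /=; rewrite addnCA. Qed.

Lemma perm_swap23 (x y z : apex_graph) : perm_eq [:: x; y; z] [:: x; z; y].
Proof. by apply/permP=> a /=; congr addn; rewrite addnCA. Qed.

Lemma spanned_swap12 x y z :
  spanned apex_col [:: x; y; z] -> spanned apex_col [:: y; x; z].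
Proof. exact: spanned_perm (perm_swap12 _ _ _). Qed.

Lemma spanned_swap23 x y z :
  spanned apex_col [:: x; y; z] -> spanned apex_col [:: x; z; y].
Proof. exact: spanned_perm (perm_swap23 _ _ _). Qed.

Lemma spanned_three s (i j l : 'I_k) : i < j -> j < l ->
  spanned apex_col [:: side s i; side s j; side s l].
Proof.
move=> ij jl; pose r := side (~~ s) j.
exists r, [:: (r, side s i); (r, side s j); (r, side s l)]; split; last first.
  by move=> x; rewrite !inE => /or3P[]/eqP->; rewrite eqxx ?orbT.
rewrite /= !inE ?side_eq !eqxx !ltnn !(ltn_ord_rules ij) !(ltn_ord_rules jl)
  !(ltn_ord_rules (ltn_trans ij jl)).
by case: s {r}.
Qed.

(** If i <= l <= j, the opposite vertex l is itself the center of a two-edge star, at most one of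
    whose edges has color 0. Otherwise a path of three edges works: its middle edge is a matching
    edge, of color 0, at j when l < i and at i when j < l, and its outer edges carry colors 1 and
    2. *)
Lemma spanned_two s (i j l : 'I_k) : i < j ->
  spanned apex_col [:: side s i; side s j; side (~~ s) l].
Proof.
move=> ij; have [il|li] := leqP i l; last first.
  have lj := ltn_trans li ij; pose r := side (~~ s) j.
  exists r, [:: (r, side s j); (r, side s i); (side s j, side (~~ s) l)].
  split; last by move=> x; rewrite !inE => /or3P[]/eqP->; rewrite eqxx ?orbT.
  rewrite /= !inE ?side_eq !eqxx !ltnn !(ltn_ord_rules ij) !(ltn_ord_rules li)
    !(ltn_ord_rules lj).
  by case: s {r}.
have [lj|jl] := leqP l j; last first.
  pose r := side (~~ s) i.
  exists r, [:: (r, side s i); (r, side s j); (side s i, side (~~ s) l)].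
  split; last by move=> x; rewrite !inE => /or3P[]/eqP->; rewrite eqxx ?orbT.
  rewrite /= !inE ?side_eq !eqxx !ltnn !(ltn_ord_rules ij) !(ltn_ord_rules jl)
    !(ltn_ord_rules (ltn_trans ij jl)).
  by case: s {r}.
pose r := side (~~ s) l.
exists r, [:: (r, side s i); (r, side s j)].
split; last by move=> x; rewrite !inE => /or3P[]/eqP->; rewrite eqxx ?orbT.
rewrite /= !inE ?side_eq !eqxx !(ltn_ord_rules ij) /r.
move: il lj; rewrite leq_eqVlt => /predU1P[/val_inj <- _|il].
  by rewrite !eqxx !(ltn_ord_rules ij); case: s {r}.
rewrite leq_eqVlt => /predU1P[/val_inj ->|lj].
  by rewrite !eqxx !(ltn_ord_rules ij); case: s {r}.
by rewrite !(ltn_ord_rules il) !(ltn_ord_rules lj); case: s {r}.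
Qed.

(** The apex edge at side [s] has the one color missing from the edges joining the opposite vertex i
    to [side s i] and [side s j]. *)
Lemma spanned_apex_same w s (i j : 'I_k) : i < j ->
  spanned apex_col [:: inr w; side s i; side s j].
Proof.
move=> ij; pose r := side (~~ s) i.
exists r, [:: (r, side s i); (r, side s j); (side s i, inr w)].
split; last by move=> x; rewrite !inE => /or3P[]/eqP->; rewrite eqxx ?orbT.
rewrite /= !inE ?side_eq !eqxx !ltnn !(ltn_ord_rules ij).
by case: s {r}.
Qed.

Lemma spanned_apex_cross w s (i j : 'I_k) :
  spanned apex_col [:: inr w; side s i; side (~~ s) j].
Proof.
exists (inr w), [:: (inr w, side s i); (inr w, side (~~ s) j)].
split; last by move=> x; rewrite !inE => /or3P[]/eqP->; rewrite eqxx ?orbT.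
by rewrite /= !inE !eqxx; case: s.
Qed.

Lemma spanned_apex w s t (i j : 'I_k) : side s i != side t j ->
  spanned apex_col [:: inr w; side s i; side t j].
Proof.
have [<-|nst] := eqVneq s t; last first.
  have -> : t = ~~ s by case: s t nst => [] [].
  by move=> _; exact: spanned_apex_cross.
rewrite side_eq eqxx -val_eqE neq_ltn => /orP[ij|ji].
  exact: spanned_apex_same.
by apply: spanned_swap23; exact: spanned_apex_same.
Qed.

Lemma spanned_side s t (i j l : 'I_k) :
  uniq [:: side s i; side s j; side t l] ->
  spanned apex_col [:: side s i; side s j; side t l].
Proof.
(* The first two vertices play symmetric roles, so their indices may be taken in increasing
   order. *)
wlog ij : i j / i < j => [IH|].
  move=> u; have := u; rewrite /= inE side_eq eqxx => /andP[/norP[+ _] _].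
  rewrite -val_eqE neq_ltn => /orP[ij|ji]; first exact: IH.
  apply: spanned_swap12; apply: (IH _ _ ji).
  by rewrite (perm_uniq (perm_swap12 _ _ _)).
have [<-|nst] := eqVneq s t; last first.
  have -> : t = ~~ s by case: s t nst => [] [].
  by move=> _; exact: spanned_two.
rewrite /= !inE !side_eq !eqxx -!val_eqE => /and3P[/norP[_ +] + _].
rewrite !neq_ltn => /orP[il|li] /orP[jl|lj]; first exact: spanned_three.
- by apply: spanned_swap23; exact: spanned_three.
(* Here j < l < i, against i < j. *)
- by have := ltn_trans (ltn_trans jl li) ij; rewrite ltnn.
- by apply: spanned_swap23; apply: spanned_swap12; exact: spanned_three.
Qed.

Lemma spanned_apex_graph (x y z : apex_graph) : uniq [:: x; y; z] ->
  spanned apex_col [:: x; y; z].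
Proof.
have apexE (w w' : 'I_b) : w = w'.
  by apply: val_inj => /=; case: (b) w w' => [] [[|?] ?] [[|?] ?].
move: x y z => [[s i]|w] [[t j]|w'] [[r l]|w''] U.
(* Without the apex, two of the three vertices share a side; they are moved to the front. A triple
   with two apex vertices is not duplicate-free, by [apexE]. *)
- have [E|nst] := eqVneq s t; first by subst t; exact: spanned_side.
  have [E|ntr] := eqVneq t r; first subst r.
    apply: spanned_swap12; apply: spanned_swap23; apply: spanned_side.
    by rewrite -(perm_uniq (perm_swap23 _ _ _)) (perm_uniq (perm_swap12 _ _ _)).
  have E : s = r by case: s t r nst ntr {U} => [] [] [].
  subst r; apply: spanned_swap23; apply: spanned_side.
  by rewrite (perm_uniq (perm_swap23 _ _ _)).
- apply: spanned_swap23; apply: spanned_swap12; apply: spanned_apex.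
  by move: U; rewrite /= inE => /andP[/norP[]].
- apply: spanned_swap12; apply: spanned_apex.
  by move: U; rewrite /= !inE => /andP[/norP[]].
- by rewrite (apexE w' w'') /= !inE !eqxx ?orbT ?andbF in U.
- by apply: spanned_apex; move: U => /and3P[_ + _]; rewrite inE.
- by rewrite (apexE w w'') /= !inE !eqxx ?orbT ?andbF in U.
- by rewrite (apexE w w') /= !inE !eqxx ?orbT ?andbF in U.
- by rewrite (apexE w w') /= !inE !eqxx ?orbT ?andbF in U.
Qed.

Lemma apex_witness : 2 < b + k.*2 ->
  t_witness (b + k.*2) 3 3 (k * k + b * k.*2).
Proof.
have cardV : #|apex_graph| = b + k.*2.
  by rewrite card_sum card_prod card_bool !card_ord mul2n addnC.
pose es : seq {set apex_graph} :=
  [seq [set side false i; side true j] | i <- enum 'I_k, j <- enum 'I_k]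
  ++ [seq [set inr w; inl si] | w <- enum 'I_b, si <- enum {: bool * 'I_k}].
have <- : size es = k * k + b * k.*2.
  rewrite size_cat !size_allpairs -!cardE card_prod card_bool !card_ord.
  by rewrite mul2n.
rewrite -cardV => V2.
apply: (@t_witness_of_spanned apex_graph apex_col) => //.
- exact: apex_col_sym.
- exact: apex_col_lt3.
- move=> [[s i]|w] [[t j]|w'] //= st; rewrite mem_cat.
  + apply/orP; left; case: s t st => [] [] // _; last first.
      by apply/allpairsP; exists (i, j); rewrite !mem_enum.
    by apply/allpairsP; exists (j, i); rewrite !mem_enum setUC.
  + apply/orP; right; apply/allpairsP; exists (w', (s, i)).
    by rewrite !mem_enum setUC.
  + by apply/orP; right; apply/allpairsP; exists (w, (t, j)); rewrite !mem_enum.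
- exact: spanned_apex_graph.
Qed.

End ApexBipartite.

(** * Edge counts in connected graphs and rainbow trees *)

Lemma connect_exit (T : finType) (e : rel T) (A : {set T}) x y :
  connect e x y -> x \in A -> y \notin A ->
  exists a b, [/\ a \in A, b \notin A & e a b].
Proof.
case/connectP=> p; elim: p x => [|z p IH] x /=; first by move=> _ -> ->.
move=> /andP[xz zp] Ey xA yA.
by have [zA|zA] := boolP (z \in A); [exact: IH zp Ey zA yA | exists x, z].
Qed.

(** Take a maximal [A] containing a root and satisfying the bound for the edges inside it. If [A]
    missed a vertex of [V], some edge would leave [A]; adding its far end brings one vertex and at
    least one new edge, contradicting maximality. *)
Lemma card_connected (T : finType) (V : {set T}) (F : {set {set T}}) :
  {in V &, forall x y, connect [rel x y | [set x; y] \in F] x y} ->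
  #|V| <= #|F|.+1.
Proof.
move=> Fcon; have [->|/set0Pn[r rV]] := eqVneq V set0; first by rewrite cards0.
pose within (A : {set T}) := [set f in F | f \subset A].
pose P (A : {set T}) := (r \in A) && (#|A| <= #|within A|.+1).
have [|A /maxsetP[/andP[rA AF] Amax] _] := @maxset_exists _ P [set r].
  by rewrite /P set11 cards1.
suff VA : V \subset A.
  apply: leq_trans (subset_leq_card VA) _; apply: leq_trans AF _; rewrite ltnS.
  by apply: subset_leq_card; apply/subsetP=> f; rewrite inE => /andP[].
apply/subsetP=> y yV; apply: contraT => yA.
have [a [b [aA bA /= ab]]] := connect_exit (Fcon r y rV yV) rA yA.
suff /Amax E : P (b |: A) by rewrite -E ?subsetUr ?setU11 in bA.
rewrite /P !inE rA orbT cardsU1 bA add1n ltnS; apply: leq_trans AF _.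
have -> : #|within A|.+1 = #|[set a; b] |: within A|.
  by rewrite cardsU1 inE subUset !sub1set (negPf bA) !andbF.
apply: subset_leq_card; apply/subsetP=> f; rewrite !inE.
case/predU1P=> [->|/andP[-> fA]]; last exact: subset_trans fA (subsetUr _ _).
by rewrite ab subUset !sub1set !inE aA eqxx orbT.
Qed.

Lemma connected_connect (G : sgraph) : connected_graph G ->
  forall x y : G, connect [rel x y | [set x; y] \in edges G] x y.
Proof.
case=> _ Gc x y; apply: connect_sub (Gc x y) => a b ab.
exact/connect1/edge_in.
Qed.

Lemma connected_card_edges (G : sgraph) :
  connected_graph G -> #|G|.-1 <= #|edges G|.
Proof.
move=> Gc; rewrite -cardsT -subn1 leq_subLR add1n.
by apply: card_connected => x y _ _; apply: connected_connect.
Qed.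

Lemma tree_card (G : sgraph) (c : edge_coloring G) (H : subgraph G) :
  rainbow_tree c H -> #|sverts H| <= #|sedges H|.+1.
Proof. by case=> [[[_ Hc] _] _]; apply: card_connected. Qed.

Lemma rainbow_card (G : sgraph) (c : edge_coloring G) (F : {set {set G}}) :
  F \subset edges G -> {in F &, injective c} -> #|F| <= num_colors c.
Proof.
move=> FG cinj; rewrite cardE -(size_map c); apply: uniq_leq_size.
  rewrite map_inj_in_uniq ?enum_uniq // => e f; rewrite !mem_enum; exact: cinj.
move=> i /mapP[e]; rewrite mem_enum => eF ->; rewrite mem_undup.
by apply: map_f; rewrite mem_enum (subsetP FG).
Qed.

Lemma rainbow_tree_card (G : sgraph) (c : edge_coloring G) (H : subgraph G) :
  rainbow_tree c H -> #|sedges H| <= num_colors c.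
Proof. by case=> _; apply: rainbow_card; exact: sedges_edges. Qed.

(** * Lower bounds and nonexistence for two colors *)

Lemma two_colors_triple (G : sgraph) (c : edge_coloring G) (S : {set G}) :
  k_rainbow_coloring 3 c -> num_colors c <= 2 -> #|S| = 3 ->
  exists e f, [/\ e \in edges G, f \in edges G, e \subset S, f \subset S
                & c e != c f].
Proof.
move=> rb c2 S3; have [H [HT SH]] := rb S S3.
have He := leq_trans (rainbow_tree_card HT) c2.
have Hv := tree_card HT.
have ES : S = sverts H.
  by apply/eqP; rewrite eqEcard SH S3; apply: leq_trans Hv _; rewrite ltnS.
have /card_gt1P[e [f [eH fH nef]]] : 1 < #|sedges H|.
  by rewrite -ltnS; apply: leq_trans Hv; rewrite -ES S3.
exists e, f; rewrite !(subsetP (sedges_edges H)) ?ES ?sedges_sverts //.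
split=> //.
by apply: contraNneq nef => /(HT.2 _ _ eH fH) ->.
Qed.

Lemma double_count (I J : finType) (A : {set I}) (B : {set J})
    (r : I -> J -> bool) :
  \sum_(i in A) #|[set j in B | r i j]| = \sum_(j in B) #|[set i in A | r i j]|.
Proof.
transitivity (\sum_(i in A) \sum_(j in B | r i j) 1).
  apply: eq_bigr => i _; rewrite -sum1_card; apply: eq_bigl => j.
  by rewrite inE.
rewrite (exchange_big_dep (mem B)) /= => [|i j _ /andP[] //].
apply: eq_bigr => j jB; rewrite -sum1_card; apply: eq_bigl => i.
by rewrite inE jB.
Qed.

(** Double counting of pairs of an edge and a vertex off it: each edge misses two vertices, and the
    three vertices other than a given one span at least two edges. *)
Lemma rx2_order4 (G : sgraph) : #|G| = 4 -> rx_le 3 G 2 -> 4 <= #|edges G|.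
Proof.
move=> G4 /rx_leP[c [rb c2]].
rewrite -(@leq_pmul2r 2) //.
have -> : #|edges G| * 2 =
    \sum_(z in [set: G]) #|[set e in edges G | z \notin e]|.
  rewrite double_count -sum_nat_const; apply: eq_bigr => e eG.
  have -> : [set z in [set: G] | z \notin e] = ~: e.
    by apply/setP=> z; rewrite !inE.
  by rewrite cardsCs setCK G4 (card_edge eG).
rewrite -[X in X * 2 <= _]G4 -cardsT -sum_nat_const.
apply: leq_sum => z _.
have [|e [f [eG fG eS fS nef]]] := @two_colors_triple _ _ (~: [set z]) rb c2.
  by rewrite cardsC1 G4.
apply/card_gt1P; exists e, f; split; last by apply: contraNneq nef => ->.
  by rewrite inE eG; apply/negP => /(subsetP eS); rewrite !inE eqxx.
by rewrite inE fG; apply/negP => /(subsetP fS); rewrite !inE eqxx.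
Qed.

(** The two-edge rainbow tree centered at [x], for a coloring with boolean values. *)
Definition vee (G : sgraph) (f : G -> G -> bool) (x y z : G) :=
  [&& adj x y, adj x z & f x y != f x z].

(** With at most two colors, comparison with a fixed color [c0] gives a boolean coloring that still
    separates edges of different colors. *)
Lemma num_colors_le2 (G : sgraph) (c : edge_coloring G) : num_colors c <= 2 ->
  exists c0, {in edges G &, forall e f,
    c e != c f -> (c e == c0) != (c f == c0)}.
Proof.
rewrite /num_colors => c2.
have mem e : e \in edges G -> c e \in undup [seq c e | e in edges G].
  by move=> eG; rewrite mem_undup map_f // mem_enum.
case: (undup _) c2 mem => [|a [|b [|? ?]]] //= _ mem.
- by exists 0 => e f /mem.
- by exists a => e f /mem + /mem; rewrite !inE => /eqP-> /eqP->; rewrite eqxx.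
- exists a => e f /mem + /mem; rewrite !inE.
  case/orP=> /eqP-> /orP[]/eqP->; rewrite ?eqxx // => /negPf.
    by rewrite [b == a]eq_sym => ->.
  by move->.
Qed.

Lemma edge_in3 (G : sgraph) (x y z : G) e :
  e \in edges G -> e \subset [set x; y; z] ->
  [\/ e = [set x; y], e = [set x; z] | e = [set y; z]].
Proof.
case/edgesP=> a [b [ab ->]]; rewrite subUset !sub1set !inE -!orbA.
have := adj_neq ab; move=> /[swap] /andP[].
by move=> /or3P[]/eqP-> /or3P[]/eqP->; rewrite ?eqxx //= => _;
   rewrite ?[[set y; x]]setUC ?[[set z; _]]setUC;
   do [by constructor 1 | by constructor 2 | by constructor 3].
Qed.

Lemma rx2_coloring (G : sgraph) : rx_le 3 G 2 ->
  exists f : G -> G -> bool, (forall x y, f x y = f y x) /\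
    forall x y z, uniq [:: x; y; z] ->
      [|| vee f x y z, vee f y x z | vee f z x y].
Proof.
case/rx_leP=> c [rb c2]; have [c0 cE] := num_colors_le2 c2.
exists (fun x y => c [set x; y] == c0); split=> [x y|x y z U].
  by rewrite setUC.
have [|e [f [eG fG eS fS nef]]] := @two_colors_triple _ _ [set x; y; z] rb c2.
  by move: U; rewrite -setUA !cardsU1 cards1 /= !inE andbT => /andP[-> ->].
have := cE _ _ eG fG nef; move: (eG) (fG) nef.
rewrite /vee ![[set _; x]]setUC [[set z; y]]setUC.
rewrite [adj y x]adj_sym [adj z x]adj_sym [adj z y]adj_sym.
by case: (edge_in3 eG eS) => ->; case: (edge_in3 fG fS) => ->;
  rewrite ?eqxx // !edge_adj => -> -> _ nef; have := nef; rewrite eq_sym => nfe;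
  rewrite ?nef ?nfe ?orbT.
Qed.

Lemma bool_pigeonhole (T : finType) (A : {set T}) (p : T -> bool) m :
  m.*2 < #|A| -> exists b, m < #|[set w in A | p w == b]|.
Proof.
rewrite -(cardsID [set w | p w] A) => mA.
have [m1|m1] := ltnP m #|A :&: [set w | p w]|.
  exists true; rewrite (eq_card (B := A :&: [set w | p w])) // => w.
  by rewrite !inE eqb_id.
exists false; rewrite (eq_card (B := A :\: [set w | p w])) => [|w].
  by rewrite -(ltn_add2l m) addnn; apply: leq_trans mA _; rewrite leq_add2r.
by rewrite !inE eqbF_neg andbC.
Qed.

Lemma rx2_complete (G : sgraph) : 5 <= #|G| -> rx_le 3 G 2 ->
  forall u v : G, u != v -> adj u v.
Proof.
move=> G5 /rx2_coloring[f [fsym fP]] u v nuv; apply: contraT => nadj.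
(* As u and v are nonadjacent, the tree on u, v, w can only be centered at w. *)
have far w : w \notin [set u; v] -> [/\ adj u w, adj v w & f u w != f v w].
  rewrite !inE => /norP[nwu nwv].
  have := fP w u v; rewrite /vee [adj v u]adj_sym (negPf nadj) /= !inE.
  rewrite negb_or nwu nwv nuv => /(_ isT); rewrite !andbF !orbF => /and3P[].
  by rewrite ![adj w _]adj_sym ![f w _]fsym.
have [|b /card_gt1P[w1 [w2 []]]] := @bool_pigeonhole _ (~: [set u; v]) (f u) 1.
  by rewrite -(leq_add2l #|[set u; v]|) cardsC cards2 nuv.
rewrite inE [_ \in ~: _]inE => /andP[w1A /eqP f1].
rewrite inE [_ \in ~: _]inE => /andP[w2A /eqP f2] nw.
have fw : f u w1 = f u w2 by rewrite f1 f2.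
have [uw1 vw1 n1] := far w1 w1A; have [uw2 vw2 n2] := far w2 w2A.
have U x : x \in [set u; v] -> uniq [:: x; w1; w2].
  move=> xuv; rewrite /= !inE nw !andbT.
  by apply/norP; split; apply: contraTneq xuv => ->.
have := fP _ _ _ (U u (set21 _ _)); have := fP _ _ _ (U v (set22 _ _)).
rewrite /vee ![f w1 _]fsym ![f w2 _]fsym.
(* Both [w1] and [w2] see u in one color and v in the other, yet the color of their edge must differ
   from both. *)
move: n1 n2; rewrite -fw.
by case: (f u w1); case: (f v w1) => //; case: (f v w2) => //;
   case: (f w1 w2); rewrite ?andbF.
Qed.

Lemma rx2_order5 (G : sgraph) :
  #|G| = 5 -> rx_le 3 G 2 -> 'C(5, 2) <= #|edges G|.
Proof.
move=> G5 G2; rewrite -{1}G5 -card_draws; apply: subset_leq_card.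
apply/subsetP=> e; rewrite inE => /cards2P[x [y [nxy ->]]].
by apply/edge_in/rx2_complete; rewrite ?G5.
Qed.

Lemma rx2_order6 (G : sgraph) : 6 <= #|G| -> ~ rx_le 3 G 2.
Proof.
move=> G6 /rx2_coloring[f [fsym fP]].
(* What remains is a boolean function on pairs without monochromatic triples, as in Ramsey's
   argument. *)
have {}fP x y z :
    uniq [:: x; y; z] -> ~~ ((f x y == f x z) && (f x y == f y z)).
  move/fP; rewrite /vee ![f z _]fsym [f y x]fsym.
  by case: (f x y); case: (f x z); case: (f y z) => //; rewrite !andbF.
have /card_gt0P[x _] : 0 < #|G| by apply: leq_trans G6.
(* Of at least five other vertices, three get the same color from [x]; any pair among them of that
   color would close a monochromatic triple. *)
have [|b] := @bool_pigeonhole _ [set~ x] (f x) 2.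
  by rewrite cardsC1; case: #|G| G6.
case/card_gt2P=> y1 [y2 [y3 [[]]]]; rewrite !inE.
move=> /andP[n1 /eqP f1] /andP[n2 /eqP f2] /andP[n3 /eqP f3] [n12 n23 n31].
have := fP x y1 y2; have := fP x y2 y3; have := fP x y1 y3; have := fP y1 y2 y3.
rewrite /= !inE ![x == _]eq_sym !negb_or [y1 == y3]eq_sym.
rewrite n1 n2 n3 n12 n23 n31 f1 f2 f3.
by case: b {f1 f2 f3}; case: (f y1 y2); case: (f y2 y3);
   case: (f y1 y3) => // ? ? ? ?; auto.
Qed.

(** * The lower bound for three colors and order five *)

Definition incident (G : sgraph) (v : G) := [set e in edges G | v \in e].

Lemma handshake (G : sgraph) (W : {set G}) :
  \sum_(v in W) #|incident v| = \sum_(e in edges G) #|e :&: W|.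
Proof.
rewrite double_count; apply: eq_bigr => e _; apply: eq_card => v.
by rewrite !inE andbC.
Qed.

(** Used in the contrapositive: in a tree, a rainbow subtree containing every leaf is spanning. *)
Lemma subtree_leaf (G : sgraph) (c : edge_coloring G) (H : subgraph G) :
  #|edges G| < #|G| -> connected_graph G -> rainbow_tree c H ->
  sverts H != setT -> exists2 v, v \notin sverts H & #|incident v| <= 1.
Proof.
move=> Gtree Gc HT nHT; set W := sverts H in nHT *; apply/exists_inP.
apply: contraT; rewrite negb_exists_in => /forall_inP noleaf.
(* At most |~: W| edges lie outside H, and they alone meet ~: W; one of them
   meets it in a single vertex, so the degrees there sum to < 2 |~: W|. *)
have /set0Pn[r rW] : W != set0 by case: HT => [[[]]].
have [y yW] : exists y, y \notin W.
  apply/existsP; rewrite -negb_forall; apply: contra nHT => /forallP W1.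
  by apply/eqP/setP=> y; rewrite W1 inE.
have [a [b [aW bW /= ab]]] := connect_exit (connected_connect Gc r y) rW yW.
pose F := edges G :\: sedges H.
have F_W : #|F| <= #|~: W|.
  rewrite cardsDS ?sedges_edges // leq_subLR.
  rewrite -ltnS -addSn; apply: leq_trans Gtree _.
  by rewrite -(cardsC W) leq_add2r; apply: tree_card HT.
have deg2 : #|~: W| * 2 <= \sum_(v in ~: W) #|incident v|.
  rewrite -sum_nat_const; apply: leq_sum => v; rewrite inE => vW.
  by rewrite ltnNge noleaf.
have abF : [set a; b] \in F.
  rewrite inE ab andbT; apply/negP => /sedges_sverts/subsetP/(_ b).
  by rewrite set22 (negPf bW) => /(_ isT).
suff : \sum_(v in ~: W) #|incident v| < #|F| * 2.
  by move/(leq_ltn_trans deg2); rewrite ltn_pmul2r // ltnNge F_W.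
rewrite handshake (big_setID (sedges H)) /= big1 => [|e]; last first.
  rewrite inE => /andP[_ eH]; apply/eqP.
  rewrite cards_eq0 setI_eq0 disjoints_subset setCK.
  exact: sedges_sverts.
rewrite add0n -/F (big_setD1 _ abF) /= (cardsD1 [set a; b] F) abF mulnDl.
rewrite -addSn leq_add //.
  rewrite ltnS -(cards1 b); apply: subset_leq_card; apply/subsetP=> v.
  by rewrite !inE => /andP[/orP[]/eqP-> //]; rewrite aW.
rewrite -sum_nat_const; apply: leq_sum => e.
rewrite in_setD1 in_setD => /and3P[_ _ eG].
by rewrite -(card_edge eG) subset_leq_card // subsetIl.
Qed.

Lemma rx3_order5 (G : sgraph) : #|G| = 5 -> connected_graph G -> rx_le 3 G 3 ->
  5 <= #|edges G|.
Proof.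
move=> G5 Gc /rx_leP[c [rb c3]]; rewrite leqNgt ltnS; apply/negP => E4.
pose L := [set v : G | #|incident v| <= 1].
(* At most three leaves: pad them to a triple. Its rainbow tree spans all five vertices, hence needs
   four edges, with three colors. *)
have [L3|L4] := leqP #|L| 3.
  have [|S LS S3] := @subset_of_card _ L 3; first by rewrite L3 G5.
  have [H [HT SH]] := rb S S3.
  have [||v vH v1] := subtree_leaf _ Gc HT; first by rewrite G5.
    apply/eqP => HV; have := tree_card HT; have := rainbow_tree_card HT.
    by rewrite HV cardsT G5; lia.
  by move: vH; rewrite (subsetP SH) // (subsetP LS) // inE.
(* The degrees sum to 8, whereas four leaves and a fifth vertex of degree at most 3 give at most
   7. *)
have [a aL] : exists a : G, 4 <= #|incident a|.
  apply/existsP; apply: contraT; rewrite negb_exists => /forallP deg3.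
  have : \sum_(v in [set: G]) #|incident v| <= #|L| * 1 + #|~: L| * 3.
    rewrite (big_setID L) /= setTI setTD -!sum_nat_const.
    apply: leq_add; apply: leq_sum => v; first by rewrite inE.
    by rewrite leqNgt deg3.
  rewrite handshake; under eq_bigr => e eG do rewrite setIT (card_edge eG).
  rewrite sum_nat_const => le_sum.
  have := connected_card_edges Gc; rewrite G5 /= => E4'.
  have := cardsC L; rewrite G5; move: le_sum E4' L4.
  by move: #|L| #|~: L| #|edges G| => l m k; lia.
have center e : e \in edges G -> a \in e.
  have /eqP/setP/(_ e) : incident a == edges G.
    rewrite eqEcard (leq_trans E4 aL) andbT; apply/subsetP=> f.
    by rewrite inE => /andP[].
  by rewrite inE => <- /andP[].
suff /(rainbow_card (subxx _)) : {in edges G &, injective c}.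
  move/leq_trans/(_ c3); apply/negP; rewrite -ltnNge; apply: leq_trans aL _.
  by apply: subset_leq_card; apply/subsetP=> f; rewrite inE => /andP[].
have spoke e : e \in edges G -> exists2 x, x != a & e = [set a; x].
  move=> eG; have := center e eG; case/edgesP: eG => x [y [xy ->]].
  have nxy := adj_neq xy; rewrite !inE => /orP[]/eqP->.
    by exists y; rewrite // eq_sym.
  by exists x; rewrite // setUC.
move=> e f eG fG cef.
have [x xa Ee] := spoke e eG; have [y ya Ef] := spoke f fG.
(* Since x and y may still coincide, the set is padded to three vertices. *)
have [|S eS S3] := @subset_of_card _ [set a; x; y] 3.
  rewrite G5 andbT -setUA !cardsU1 cards1.
  by case: (_ \notin _); case: (_ \notin _).
have [H [HT SH]] := rb S S3.
(* The tree must leave [z] towards [a], and every edge contains [a], so it uses the spoke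
   [[set a; z]]. *)
have inH z : z != a -> z \in [set a; x; y] -> [set a; z] \in sedges H.
  move=> za zS.
  have aH : a \in sverts H by rewrite (subsetP SH) // (subsetP eS) // !inE eqxx.
  have zH : z \in sverts H by rewrite (subsetP SH) // (subsetP eS).
  have [[[_ Hc] _] _] := HT.
  have [|p [q [/set1P-> _ zq]]] := connect_exit (Hc z a zH aH) (set11 z).
    by rewrite inE eq_sym.
  have := center _ (subsetP (sedges_edges H) _ zq).
  by rewrite !inE [a == z]eq_sym (negPf za) => /eqP->; rewrite setUC.
apply: HT.2 => //; by rewrite ?Ee ?Ef inH // !inE eqxx ?orbT.
Qed.

Theorem proposition2p1 (n : nat) (hn : 3 <= n) :
  ([/\ is_t 3 3 2 2, is_t 4 3 2 4, is_t 5 3 2 'C(5, 2)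
     & 6 <= n ->
       ~ exists G : sgraph, [/\ #|G| = n, connected_graph G & rx_le 3 G 2]])
  /\
  ([/\ is_t 3 3 3 2, is_t 4 3 3 3, is_t 5 3 3 5
     & 6 <= n ->
       t_le n 3 3 (if odd n then ((n + 3) * (n - 1)) %/ 4 else n ^ 2 %/ 4)]).
Proof.
split; split.
- apply: is_t_of_witness witness_3_2 _ => G G3 Gc _.
  by have := connected_card_edges Gc; rewrite G3.
- by apply: is_t_of_witness witness_4_2 _ => G G4 _; exact: rx2_order4.
- by apply: is_t_of_witness witness_5_2 _ => G G5 _; exact: rx2_order5.
- by move=> n6 [G [Gn _]]; apply: rx2_order6; rewrite Gn.
- apply: is_t_of_witness witness_3_3 _ => G G3 Gc _.
  by have := connected_card_edges Gc; rewrite G3.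
- apply: is_t_of_witness witness_4_3 _ => G G4 Gc _.
  by have := connected_card_edges Gc; rewrite G4.
- by apply: is_t_of_witness witness_5_3 _ => G; exact: rx3_order5.
move=> n6; apply: t_le_of_witness.
(* Instantiate with [k = n./2] and an apex exactly when n is odd: k^2 = n^2/4 for n = 2k, and k^2 +
   2k = (n+3)(n-1)/4 for n = 2k+1, so both divisions are exact. *)
have En := odd_double_half n.
have : 2 < odd n + n./2.*2 by rewrite En.
move/apex_witness; rewrite En => -[G [Gn Gc Grx Gm]].
exists G; split=> //; apply: leq_trans Gm _.
move: En; move: n./2 => k; case: (odd n) => En; rewrite leq_divRL // -En.
  by apply: eq_leq; rewrite -!muln2; nia.
by apply: eq_leq; rewrite -!muln2; nia.
Qed.
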